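(* Let $\mu$ be a Radon measure on $\mathbb{R}$ with positive Fourier dimension and let $\alpha\ge 2$ be an integer. Then for $\mu$-almost all real numbers $x$, the number $\sum_{n=1}^\infty \frac{[((n-1)!)^\alpha x]}{(n!)^\alpha}$ as well as the number $\sum_{n=1}^\infty (-1)^n \frac{[(n-1)!\, x\,[\log_2 n]]}{n!}$ are irrational.
   Context: For a real number $y$, $[y]$ denotes the integer part of $y$ and $\log_2$ is the base-$2$ logarithm. For a Radon measure $\mu$ on $\mathbb{R}$, its Fourier transform is $\hat{\mu}(t)=\int_{-\infty}^\infty e^{-2\pi i x t}\,d\mu(x)$, and its Fourier dimension is $\dim_F(\mu)=\sup\{\eta\ge 0 : |\hat{\mu}(t)|\ll (1+|t|)^{-\eta/2}\}$. ''Positive Fourier dimension'' means $\dim_F(\mu)>0$. *)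

(* Defs.v *)
From HB Require Import structures.
From mathcomp Require Export all_boot all_order all_algebra.
From mathcomp Require Export all_classical all_reals all_analysis.
From mathcomp Require Import complex.
Import Order.TTheory GRing.Theory Num.Theory.
Import numFieldNormedType.Exports.

Set Implicit Arguments.
Unset Strict Implicit.
Unset Printing Implicit Defensive.

Local Open Scope classical_set_scope.
Local Open Scope ring_scope.

(* [measurableTypeR R] carries the Borel sigma-algebra of [R]. *)
Definition radon_measure (R : realType)
    (mu : {measure set (measurableTypeR R) -> \bar R}) : Prop :=
  (forall K : set R, compact K -> (mu K < +oo)%E) /\
  (forall A : set (measurableTypeR R), measurable A ->
     mu A = ereal_sup [set mu K | K in [set K : set R | compact K /\ K `<=` A]]).

(* e^{iy} *)
Definition expi (R : realType) (y : R) : R[i] := Complex (cos y) (sin y).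

Definition complex_integrable (R : realType)
    (mu : {measure set (measurableTypeR R) -> \bar R}) (f : R -> R[i]) : Prop :=
  mu.-integrable setT (fun x : measurableTypeR R => (complex.Re (f x))%:E) /\
  mu.-integrable setT (fun x : measurableTypeR R => (complex.Im (f x))%:E).

Definition complex_integral (R : realType)
    (mu : {measure set (measurableTypeR R) -> \bar R}) (f : R -> R[i]) : R[i] :=
  Complex (Rintegral mu setT (fun x : measurableTypeR R => complex.Re (f x)))
          (Rintegral mu setT (fun x : measurableTypeR R => complex.Im (f x))).

Definition fourier_kernel (R : realType) (t x : R) : R[i] :=
  expi (- (2 * pi * x * t)).

Definition fourier_transform (R : realType)
    (mu : {measure set (measurableTypeR R) -> \bar R}) (t : R) : R[i] :=
  complex_integral mu (fourier_kernel t).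

(* [Rintegral] takes the value 0 on some non-integrable functions, so the
   existence of the integral defining the Fourier transform is required
   explicitly; it amounts to [mu setT < +oo]. *)
Definition fourier_decay (R : realType)
    (mu : {measure set (measurableTypeR R) -> \bar R}) (eta : R) : Prop :=
  (forall t : R, complex_integrable mu (fourier_kernel t)) /\
  (exists C : R, forall t : R,
     Normc.normc (fourier_transform mu t) <= C * (1 + `|t|) `^ (- (eta / 2))).

(* If the Fourier transform does not exist, this is the supremum of the empty
   set, -oo. *)
Definition fourier_dim (R : realType)
    (mu : {measure set (measurableTypeR R) -> \bar R}) : \bar R :=
  ereal_sup [set eta%:E | eta in [set eta : R | 0 <= eta /\ fourier_decay mu eta]].

Definition log2 (R : realType) (y : R) : R := ln y / ln 2.

Definition floorR (R : realType) (y : R) : R := (Num.floor y)%:~R.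

(* The value of the series u 1 + u 2 + ... is irrational; the series is not
   required to converge absolutely. *)
Definition irrational_series (R : realType) (u : nat -> R) : Prop :=
  exists2 s : R,
    (\sum_(1 <= n < N) u n) @[N --> \oo] --> s & irrational s.

(* Main.v *)
Require Import Defs.
From mathcomp Require Import complex measurable_realfun ring lra zify.
Import Order.TTheory GRing.Theory Num.Theory.
Import numFieldNormedType.Exports.
Local Open Scope classical_set_scope.
Local Open Scope ring_scope.

(** In both series the n-th term is [e_n floor(d_(n-1) x l_n) / d_n], where
    [d_n] is a multiple of [d_(n-1)] and [e_n], [l_n] are integers.  Dropping the
    floors gives [x V], with [V] the sum of the slopes
    [v_n = e_n l_n d_(n-1) / d_n].  If the sum were rational with denominator
    [q], multiplying the tail beyond [N] by [q d_N] would give an integer, so that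
    [q d_N (V - V_N) x] lies within [q / N] of an integer for every [N].  The
    frequencies [s_N = q d_N (V - V_N)] are unbounded, and since the Fourier
    transform of [mu] vanishes at infinity, the sums of [cos (2 pi s_N x)] over
    sparse sets of [M] indices have second moment [o(M^2)]; hence the set of [x]
    for which these cosines are eventually at least 1/2 is [mu]-null.  There are
    only countably many [q]. *)

(** * Integrals of finite sums, periodicity of cosine, tails of series *)

Lemma integrable_Rintegral_sum (dT : measure_display) (T : measurableType dT)
    (R : realType) (mu : {measure set T -> \bar R})
    (I : Type) (r : seq I) (f : I -> T -> R) :
  (forall i, mu.-integrable setT (EFin \o f i)) ->
  mu.-integrable setT (EFin \o (fun x => \sum_(i <- r) f i x)) /\
  Rintegral mu setT (fun x => \sum_(i <- r) f i x) =
    \sum_(i <- r) Rintegral mu setT (f i).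
Proof.
move=> fi; have ri (s : seq I) :
    mu.-integrable setT (EFin \o (fun x => \sum_(i <- s) f i x)).
  rewrite (_ : EFin \o _ = (fun x => \sum_(i <- s) (f i x)%:E)%E).
    by apply: integrable_sum => // i _; exact: fi.
  by apply/funext => x /=; rewrite sumEFin.
split=> //; elim: r => [|i r IH].
  under eq_Rintegral do rewrite big_nil.
  by rewrite big_nil Rintegral_cst ?mul0r.
under eq_Rintegral do rewrite big_cons.
by rewrite big_cons RintegralD// IH.
Qed.

Lemma cos_int_period (R : realType) (z : int) (y : R) : cos (2 * pi * z%:~R + y) = cos y.
Proof.
have nat_period (n : nat) (w : R) : cos (w + 2 * pi * n%:R) = cos w.
  rewrite -[RHS](periodicn (@cosD2pi R) n); congr cos.
  by rewrite -mulr_natr -mulr_natl; ring.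
case: z => n; first by rewrite addrC nat_period.
rewrite NegzE mulrNz -[LHS](nat_period n.+1); congr cos.
by rewrite -pmulrn; ring.
Qed.

Lemma cvg_tail_le (R : realType) (a : nat -> R) (E b : R) (N : nat) : (0 < N)%N ->
  (\sum_(1 <= n < M) a n) @[M --> \oo] --> E ->
  (forall M, (N <= M)%N -> \sum_(N <= n < M) `|a n| <= b) ->
  `|E - \sum_(1 <= n < N) a n| <= b.
Proof.
move=> N0 cE hb.
have c : `|\sum_(1 <= n < M) a n - \sum_(1 <= n < N) a n| @[M --> \oo]
    --> `|E - \sum_(1 <= n < N) a n|.
  by apply: cvg_norm; apply: cvgB => //; exact: cvg_cst.
apply: (cvgr_to_le c); near=> M.
have NM : (N <= M)%N by near: M; exact: nbhs_infty_ge.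
rewrite (big_cat_nat N0 NM)//= addrAC subrr add0r.
by apply: le_trans (ler_norm_sum _ _ _) (hb _ NM).
Unshelve. all: by end_near. Qed.

(** * Cosine waves against a measure whose cosine transform vanishes at infinity *)

Section RajchmanMeasures.
Context (R : realType) (mu : {measure set (measurableTypeR R) -> \bar R}).
Local Notation Rm := (measurableTypeR R).
Implicit Types (s t x : R).

Let wave t : Rm -> R := fun x => cos (2 * pi * x * t).

Hypothesis wave_integrable :
  forall t, mu.-integrable setT (EFin \o wave t).
Hypothesis wave_decay :
  forall e : R, 0 < e -> exists T : R, forall t, T <= `|t| ->
    `|Rintegral mu setT (wave t)| <= e.

Lemma wave_mul s t x : wave s x * wave t x = (wave (s - t) x + wave (s + t) x) / 2.
Proof.
by rewrite /wave (mulrBr _ s) (mulrDr _ s) cosB (cosD (_ * s)); field.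
Qed.

(** [wave 0] is constantly 1, so this is the total mass of [mu] as a real number. *)
Let mass := Rintegral mu setT (wave 0).

Lemma wave_le_mass t : `|Rintegral mu setT (wave t)| <= mass.
Proof.
apply: le_trans (le_normr_Rintegral measurableT (wave_integrable t)) _.
apply: le_Rintegral => //.
  rewrite (_ : EFin \o _ = abse \o (EFin \o wave t))//.
  exact/integrable_abse.
  exact: wave_integrable.
by move=> x _; rewrite /wave mulr0 cos0 ler_norml cos_geN1 cos_le1.
Qed.

(** The product-to-sum formula turns correlations of waves into values of the cosine transform, to
    which decay applies. *)
Lemma wave_mul_integrable s t :
  mu.-integrable setT (EFin \o (fun x => wave s x * wave t x)) /\
  Rintegral mu setT (fun x => wave s x * wave t x) =
  (Rintegral mu setT (wave (s - t)) + Rintegral mu setT (wave (s + t))) / 2.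
Proof.
have -> : (fun x => wave s x * wave t x) =
    (fun x => 2^-1 * (wave (s - t) x + wave (s + t) x)).
  by apply/funext => x; rewrite wave_mul mulrC.
have iD : mu.-integrable setT (EFin \o (fun x => wave (s - t) x + wave (s + t) x)).
  rewrite (_ : EFin \o _ = (EFin \o wave (s - t)) \+ (EFin \o wave (s + t)))%E//.
  exact: integrableD.
split; last by rewrite RintegralZl// RintegralD// mulrC.
move: iD; set g := (X in EFin \o X) => iD.
rewrite (_ : EFin \o _ = (fun x => 2^-1%:E * (EFin \o g) x)%E)//.
exact: integrableZl.
Qed.

(* The second moment of the sum of the first M waves is at least
   mu(A) M^2 / 4, while for well separated frequencies it is O(M) + o(M^2). *)
Lemma separated_waves_bound (A : set Rm) (T e : R) (M : nat) (r : nat -> R) :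
  measurable A -> 0 <= e ->
  (forall t, T <= `|t| -> `|Rintegral mu setT (wave t)| <= e) ->
  (forall k, T <= r k) -> (forall k l, (k < l)%N -> r k + T <= r l) -> 0 <= T ->
  (forall k x, A x -> 1 / 2 <= wave (r k) x) ->
  fine (mu A) * M%:R ^+ 2 <= 2 * mass * M%:R + 4 * e * M%:R ^+ 2.
Proof.
move=> mA e0 dec rT sep T0 Aw.
pose F x := \sum_(k < M) wave (r k) x.
have F2 : (fun x => F x ^+ 2) =
    (fun x => \sum_(k < M) \sum_(l < M) wave (r k) x * wave (r l) x).
  apply/funext => x; rewrite /F expr2 mulr_suml.
  by apply: eq_bigr => k _; rewrite mulr_sumr.
have w2 k l := wave_mul_integrable (r k) (r l).
have inner (k : 'I_M) := integrable_Rintegral_sum _ _ _ mu _ (index_enum 'I_M)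
  (fun (l : 'I_M) x => wave (r k) x * wave (r l) x) (fun l => (w2 k l).1).
have [F2i F2E] := integrable_Rintegral_sum _ _ _ mu _ (index_enum 'I_M)
  (fun (k : 'I_M) x => \sum_(l < M) wave (r k) x * wave (r l) x)
  (fun k => (inner k).1).
have F2le : Rintegral mu setT (fun x => F x ^+ 2) <= mass * M%:R / 2 + e * M%:R ^+ 2.
  rewrite F2 F2E.
  (* Diagonal pairs contribute at most [mass / 2 + e], the others at most [e]. *)
  have -> : mass * M%:R / 2 + e * M%:R ^+ 2 =
      \sum_(k < M) \sum_(l < M) ((if l == k then mass else 0) / 2 + e).
    under eq_bigr do rewrite big_split/= -mulr_suml -big_mkcond/= big_pred1_eq.
    rewrite big_split/= !sumr_const !card_ord -!mulrnA -mulr_natr.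
    by rewrite -[e *+ _]mulr_natr natrM; field.
  apply: ler_sum => k _; rewrite (inner k).2; apply: ler_sum => l _.
  rewrite (w2 k l).2.
  have Hp : Rintegral mu setT (wave (r k + r l)) <= e.
    apply: le_trans (ler_norm _) (dec _ _).
    by rewrite ger0_norm; have := rT k; have := rT l; lra.
  suff : Rintegral mu setT (wave (r k - r l)) <= (if l == k then mass else 0) + e.
    by move: (Rintegral _ _ _) Hp (Rintegral _ _ _) (if _ then _ else _) => *; lra.
  case: eqVneq => [_|kl].
    have := wave_le_mass (r k - r l); rewrite ler_norml => /andP[_]; lra.
  rewrite add0r; apply: le_trans (ler_norm _) (dec _ _).
  case: (ltngtP k l) => [h|h|/val_inj h]; last by rewrite h eqxx in kl.
    have hs := sep _ _ h; rewrite distrC ger0_norm; lra.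
  have hs := sep _ _ h; rewrite ger0_norm; lra.
have fin : (mu setT < +oo)%E.
  have /integrableP[_] := wave_integrable 0.
  under eq_integral do rewrite /= /wave mulr0 cos0 normr1.
  by rewrite integral_cst// mul1e.
have Ai : mu.-integrable setT (EFin \o (\1_A : Rm -> R)).
  rewrite /= ; apply: measurable_bounded_integrable => //.
  exists 1; split => // y y1 x _ /=.
  rewrite indicE; case: (x \in A) => /=; rewrite ?normr1 ?normr0; lra.
(* Chebyshev's argument: on [A] every wave is at least 1/2, so [F x] is at least M/2 there. *)
have : Rintegral mu setT (fun x => (M%:R ^+ 2 / 4) * \1_A x)
    <= Rintegral mu setT (fun x => F x ^+ 2).
  apply: le_Rintegral => //.
  - rewrite (_ : EFin \o _ = (fun x => (M%:R ^+ 2 / 4)%:E *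
      (EFin \o (\1_A : Rm -> R)) x)%E)//.
    exact: integrableZl.
  - by rewrite F2.
  move=> x _; rewrite indicE; case: (asboolP (A x)) => Ax; last first.
    by rewrite memNset// mulr0 sqr_ge0.
  rewrite mem_set// mulr1.
  have : M%:R / 2 <= F x.
    have -> : M%:R / 2 = \sum_(k < M) (1 / 2 : R).
      by rewrite sumr_const card_ord -mulr_natr; field.
    by apply: ler_sum => k _; exact: Aw.
  have : 0 <= M%:R :> R by [].
  move: (M%:R) (F x) => m f; nra.
rewrite RintegralZl//.
have -> : Rintegral mu setT (\1_A : Rm -> R) = fine (mu A).
  by rewrite /Rintegral integral_indic// setIT.
move: F2le; lra.
Qed.

(** For each fixed [K], well separated frequencies can be picked beyond index [K]; the second-moment
    bound, with M large and then e small, forces measure zero. The union over [K] is countable. *)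
Lemma wave_ev_large_negligible (s : nat -> R) :
  (forall (T : R) (K : nat), exists2 N : nat, (K <= N)%N & T <= `|s N|) ->
  mu.-negligible [set x : Rm | exists K : nat, forall N : nat, (K <= N)%N ->
                   1 / 2 <= cos (2 * pi * x * s N)].
Proof.
move=> hs.
pose A K := [set x : Rm | forall N : nat, (K <= N)%N -> 1 / 2 <= wave (s N) x].
apply: (@negligibleS _ _ _ _ (\bigcup_K A K)).
  by move=> x [K Kx]; exists K.
apply: negligible_bigcup => K.
have mwave t : measurable_fun setT (wave t).
  by apply/measurable_EFinP; case/integrableP: (wave_integrable t).
have mA : measurable (A K).
  rewrite (_ : A K = \bigcap_(N in [set N | (K <= N)%N])
      (wave (s N) @^-1` `[1 / 2, +oo[)).
    apply: bigcap_measurable; first by exists K => /=.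
    by move=> N _; rewrite -[X in measurable X]setTI; exact: mwave.
  by apply/seteqP; split => x /= h N /h; rewrite /= in_itv/= andbT.
apply/negligibleP => //.
have fin : (mu (A K) < +oo)%E.
  apply: (@le_lt_trans _ _ (mu setT)); first by apply: le_measure; rewrite ?inE.
  have /integrableP[_] := wave_integrable 0.
  under eq_integral do rewrite /= /wave mulr0 cos0 normr1.
  by rewrite integral_cst// mul1e.
have fn : mu (A K) \is a fin_num by rewrite ge0_fin_numE.
suff bound (e : R) (M : nat) : 0 < e ->
    fine (mu (A K)) * M%:R ^+ 2 <= 2 * mass * M%:R + 4 * e * M%:R ^+ 2.
  apply: (etrans (esym (fineK fn))); congr (_%:E).
  apply/eqP; rewrite eq_le fine_ge0// andbT.
  apply/ler_addgt0Pr => e e0; rewrite add0r.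
  have mass0 : 0 <= mass by apply: le_trans (wave_le_mass 0).
  (* With decay level e/8 and M above 4 mass / e, each of the two terms of the bound is at most
     (e/2) M^2. *)
  pose M := (Num.truncn (4 * mass / e)).+1.
  have hM : 4 * mass / e < M%:R.
    by rewrite /M truncnS_gt.
  have M0 : 0 < M%:R :> R by rewrite ltr0n.
  have e8 : 0 < e / 8 by lra.
  have := bound (e / 8) M e8.
  move: hM; rewrite ltr_pdivrMr// => hM.
  have : 4 * mass * M%:R <= M%:R * e * M%:R by rewrite ler_pM2r// ltW.
  move: (fine _) (M%:R) M0 => a m m0 h1 h2.
  have : a * m ^+ 2 <= e * m ^+ 2 by nra.
  by rewrite ler_pM2r// exprn_gt0.
move=> e0; have [T0 dec0] := wave_decay _ e0.
pose T := Num.max T0 0.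
have dec t : T <= `|t| -> `|Rintegral mu setT (wave t)| <= e.
  by rewrite ge_max => /andP[/dec0].
have T_ge0 : 0 <= T by rewrite le_max lexx orbT.
have /choice[next nextP] : forall a : R, exists N : nat, (K <= N)%N /\ a + T <= `|s N|.
  by move=> a; have [N] := hs (a + T) K; exists N.
(* Greedy choice: each new frequency exceeds the previous one by at least [T] in absolute value. *)
pose idx := fix idx k := if k is k'.+1 then next `|s (idx k')| else next 0.
pose r k := `|s (idx k)|.
have rS k : r k + T <= r k.+1 by have [] := nextP (r k).
have sep k l : (k < l)%N -> r k + T <= r l.
  elim: l => // l IH; rewrite ltnS leq_eqVlt => /predU1P[->//|/IH h].
  apply: (le_trans h); apply: le_trans (rS l); lra.
apply: (@separated_waves_bound (A K) T e M r) => //.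
- exact: ltW.
- have r0 : T <= r 0 by have [_] := nextP 0; rewrite add0r.
  by case=> [//|k]; have := sep 0 k.+1 isT; lra.
- move=> k x Ax; have Kk : (K <= idx k)%N by case: k => [|k]; apply: (nextP _).1.
  (* Cosine is even, so taking absolute values of frequencies changes no wave. *)
  have := Ax _ Kk; rewrite /wave /r.
  by case: (ger0P (s (idx k))) => // _; rewrite mulrN cosN.
Qed.

End RajchmanMeasures.

(** The cosine integral is the real part of the Fourier transform, hence bounded by its modulus,
    which tends to 0 because [eta] is positive. *)
Lemma cos_integral_decay (R : realType)
    (mu : {measure set (measurableTypeR R) -> \bar R}) (eta : R) :
  0 < eta -> fourier_decay mu eta ->
  forall e : R, 0 < e -> exists T : R, forall t : R, T <= `|t| ->
    `|Rintegral mu setT (fun x : measurableTypeR R => cos (2 * pi * x * t))| <= e.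
Proof.
move=> eta0 [_ [C hC]] e e0.
have C0 : 0 <= C.
  have := hC 0; rewrite normr0 addr0 powR1 mulr1; apply: le_trans.
  by rewrite sqrtr_ge0.
pose p := eta / 2.
have p0 : 0 < p by rewrite /p; lra.
(* Obtained by solving C / T^p = e for T. *)
exists ((C / e) `^ p^-1) => t ht.
have t1 : 0 < 1 + `|t| by have := normr_ge0 t; lra.
apply: (@le_trans _ _ (Normc.normc (fourier_transform mu t))).
  rewrite (_ : Rintegral _ _ _ = complex.Re (fourier_transform mu t)); last first.
    by apply: eq_Rintegral => x _; rewrite /= cosN.
  case: (fourier_transform mu t) => a b /=.
  by rewrite -sqrtr_sqr ler_wsqrtr// lerDl sqr_ge0.
apply: le_trans (hC t) _.
rewrite powRN -/p ler_pdivrMr ?powR_gt0//.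
rewrite mulrC -ler_pdivrMr//.
have Ce : 0 <= C / e by rewrite divr_ge0// ltW.
have -> : C / e = ((C / e) `^ p^-1) `^ p.
  by rewrite -powRrM mulVf ?gt_eqF// powRr1.
apply: ge0_ler_powR; rewrite ?nnegrE ?powR_ge0//.
- exact: ltW p0.
- by apply: (le_trans ht); rewrite lerDr.
Qed.

(** * Floor series over a chain of denominators, each dividing the next *)

Section FloorSeries.
Context (R : realType) (d l : nat -> nat) (e : nat -> int) (V : R).
Hypothesis d_gt0 : forall n, (0 < d n)%N.
Hypothesis d_dvd : forall n, (d n %| d n.+1)%N.
Hypothesis d_grow : forall n, (n.+1 * d n <= d n.+1)%N.
Hypothesis e_le1 : forall n, `|(e n)%:~R : R| <= 1.

Definition floor_term (x : R) (n : nat) : R :=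
  (e n)%:~R * (floorR ((d n.-1)%:R * x * (l n)%:R) / (d n)%:R).

Definition slope_term (n : nat) : R :=
  (e n)%:~R * ((d n.-1)%:R * (l n)%:R / (d n)%:R).

(** This is e_n {d_(n-1) x l_n} / d_n, the error made by dropping the floor. *)
Definition frac_term (x : R) (n : nat) : R :=
  x * slope_term n - floor_term x n.

Hypothesis slope_cvg : (\sum_(1 <= n < N) slope_term n) @[N --> \oo] --> V.

Lemma d_dvd_le m n : (m <= n)%N -> (d m %| d n)%N.
Proof.
elim: n => [|n IH]; first by rewrite leqn0 => /eqP ->.
by rewrite leq_eqVlt => /predU1P[->//|/IH h]; apply: dvdn_trans h (d_dvd n).
Qed.

Let dR_gt0 n : 0 < (d n)%:R :> R.
Proof. by rewrite ltr0n. Qed.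

Lemma norm_frac_term_le x n : `|frac_term x n| <= (d n)%:R^-1.
Proof.
rewrite /frac_term /slope_term /floor_term.
set y := (d n.-1)%:R * x * (l n)%:R.
have -> : x * ((e n)%:~R * ((d n.-1)%:R * (l n)%:R / (d n)%:R))
   - (e n)%:~R * (floorR y / (d n)%:R) = (e n)%:~R * ((y - floorR y) / (d n)%:R).
  by rewrite /y; field; rewrite gt_eqF.
have /andP[f1 f2] := floor_itv y.
have f0 : 0 <= y - floorR y by rewrite subr_ge0.
have f1' : y - floorR y <= 1.
  by rewrite lerBlDl ltW//; move: f2; rewrite intrD.
rewrite !normrM normfV (ger0_norm f0) (ger0_norm (ltW (dR_gt0 n))).
rewrite -[leRHS]mul1r mulrA ler_pM2r ?invr_gt0//.
by apply: mulr_ile1.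
Qed.

(* d_n >= (N + 1) d_(n-1) beyond N makes 1/d_n telescope against 1/N. *)
Lemma sum_norm_frac_term_le x N M : (0 < N)%N -> (N <= M)%N ->
  \sum_(N.+1 <= n < M.+1) `|frac_term x n| <=
    N%:R^-1 * ((d N)%:R^-1 - (d M)%:R^-1).
Proof.
move=> N0; elim: M => [|M IH] NM.
  by move: N0; rewrite ltnNge NM.
move: NM; rewrite leq_eqVlt => /predU1P[<-|NM].
  by rewrite big_geq// subrr mulr0.
rewrite big_nat_recr//=; apply: (le_trans (lerD (IH NM) (norm_frac_term_le x M.+1))).
have NR : 0 < N%:R :> R by rewrite ltr0n.
suff : (d M.+1)%:R^-1 <= N%:R^-1 * ((d M)%:R^-1 - (d M.+1)%:R^-1) :> R by lra.
rewrite ler_pdivlMl//.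
suff : (N%:R + 1) * (d M.+1)%:R^-1 <= (d M)%:R^-1 :> R by lra.
rewrite ler_pdivrMr// ler_pdivlMl//.
rewrite mulrC natr1 -natrM ler_nat (leq_trans _ (d_grow M))// leq_mul2r.
by rewrite ltnS -ltnS NM orbT.
Qed.

(** The convergence is absolute: the telescoping bound at N = 1 controls all terms but the first.
    The sequence [a] is padded with 0 at index 0. *)
Lemma frac_cvg x : exists E : R,
  (\sum_(1 <= n < N) frac_term x n) @[N --> \oo] --> E.
Proof.
pose a n := if n is 0%N then 0 else frac_term x n.
have aE (f : R -> R) N : f 0 = 0 ->
    \sum_(0 <= n < N) f (a n) = \sum_(1 <= n < N) f (frac_term x n).
  move=> f0; case: N => [|N]; first by rewrite !big_geq.
  by rewrite big_nat_recl//= f0 add0r big_add1.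
have cn : cvgn [normed series a].
  apply: nondecreasing_is_cvgn.
    by apply: (@nondecreasing_series _ _ xpredT) => n _ _; exact: normr_ge0.
  exists (`|frac_term x 1| + 1) => _ [N _ <-].
  have -> : [normed series a] N = \sum_(1 <= n < N) `|frac_term x n|.
    exact: (aE (fun y => `|y|) N (normr0 _)).
  case: N => [|[|N]]; [by rewrite big_geq// addr_ge0..|].
  rewrite big_ltn// lerD2l.
  have := sum_norm_frac_term_le x 1 N.+1 isT isT.
  rewrite invr1 mul1r => /le_trans; apply.
  apply: (@le_trans _ _ (d 1)%:R^-1).
    by rewrite gerBl invr_ge0 ltW.
  by rewrite invf_le1// ler1n.
have := normed_cvg cn => /cvg_ex[E cE]; exists E.
by under eq_fun do rewrite -(aE id)//.
Qed.

(** Every d_n with n at most N divides d_N, which therefore clears all denominators. *)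
Lemma floor_sum_int x N :
  exists z : int, (d N)%:R * \sum_(1 <= n < N.+1) floor_term x n = z%:~R :> R.
Proof.
exists (\sum_(1 <= n < N.+1) e n * (Num.floor ((d n.-1)%:R * x * (l n)%:R))
   * (d N %/ d n)%N%:Z).
rewrite mulr_sumr rmorph_sum/=; apply: eq_big_nat => n /andP[_ nN].
have h : (d N)%:R = (d N %/ d n)%:R * (d n)%:R :> R.
  by rewrite -natrM divnK// d_dvd_le.
rewrite h !rmorphM/= -pmulrn /floor_term /floorR; field.
by rewrite gt_eqF.
Qed.

Lemma floor_series_cvg x : exists2 S : R,
  (\sum_(1 <= n < N) floor_term x n) @[N --> \oo] --> S &
  rational S -> exists q K : nat, forall N : nat, (K <= N)%N ->
    1 / 2 <= cos (2 * pi * x *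
      (q.+1%:R * ((d N)%:R * (V - \sum_(1 <= n < N.+1) slope_term n)))).
Proof.
have [E cE] := frac_cvg x.
have sumE N : \sum_(1 <= n < N) floor_term x n =
    x * \sum_(1 <= n < N) slope_term n - \sum_(1 <= n < N) frac_term x n.
  by rewrite mulr_sumr -sumrB; apply: eq_bigr => n _; rewrite /frac_term; ring.
exists (x * V - E).
  under eq_fun do rewrite sumE.
  by apply: cvgB => //; apply: cvgM => //; exact: cvg_cst.
move=> /rationalP[a0 [b0 SE0]].
(* A zero denominator is possible in [rationalP]; the quotient is then 0 by convention and is
   rewritten as 0/1. *)
have [a [q SE]] : exists (a : int) (q : nat), x * V - E = a%:~R / q.+1%:R.
  case: b0 SE0 => [|q] h; last by exists a0, q.
  by exists 0, 0%N; rewrite h invr0 mulr0 mul0r.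
(* Continuity at 0 gives a radius [r] within which cosine stays at least 1/2. *)
have := @continuous_cos R 0.
move=> /cvgrPdist_le /(_ (1 / 2)).
rewrite cos0 => /(_ ltac:(lra)) /nbhs_ballP[r /= r0 rP].
(* Beyond this index, 2 pi (q+1) / N is smaller than [r]. *)
exists q, (Num.truncn (2 * pi * q.+1%:R / r)).+2 => N KN.
have N0 : (0 < N)%N by apply: leq_trans KN.
have NR : 0 < N%:R :> R by rewrite ltr0n.
have tail : `|E - \sum_(1 <= n < N.+1) frac_term x n| <= N%:R^-1 / (d N)%:R.
  apply: cvg_tail_le => // -[//|M] NM.
  apply: le_trans (sum_norm_frac_term_le x N M N0 NM) _.
  by rewrite ler_pM2l ?invr_gt0// gerBl invr_ge0 ltW.
have [z zE] := floor_sum_int x N.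
set D := (d N)%:R in tail zE *.
(* The deviation from an integer; by [tail] it is at most (q+1) / N in absolute value. *)
pose del := q.+1%:R * (D * (E - \sum_(1 <= n < N.+1) frac_term x n)).
have -> : 2 * pi * x * (q.+1%:R * (D * (V - \sum_(1 <= n < N.+1) slope_term n)))
  = 2 * pi * (a * (d N)%:Z - q.+1%:Z * z)%:~R + 2 * pi * del.
  have : D * (x * V - E - \sum_(1 <= n < N.+1) floor_term x n) =
     D * (a%:~R / q.+1%:R) - z%:~R by rewrite mulrBr zE SE.
  rewrite sumE => h; rewrite rmorphB !rmorphM/= -!pmulrn -/D /del.
  have -> : a%:~R * D - q.+1%:R * z%:~R = q.+1%:R * (D * (a%:~R / q.+1%:R) - z%:~R).
    by field; rewrite gt_eqF ?ltr0n.
  by rewrite -h; ring.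
rewrite cos_int_period.
suff /rP /= : ball 0 r (2 * pi * del).
  by rewrite ler_distlC => /andP[]; lra.
rewrite -ball_normE /ball_/= sub0r normrN !normrM.
have pi0 : 0 < pi :> R := pi_gt0 R.
have D0 : 0 < D := dR_gt0 N.
rewrite (ger0_norm (ltW pi0)) (ger0_norm (ltW D0)) !normr_nat.
have : D * `|E - \sum_(1 <= n < N.+1) frac_term x n| <= N%:R^-1.
  by rewrite mulrC -ler_pdivlMr.
move=> h; apply: (@le_lt_trans _ _ (2 * pi * (q.+1%:R * N%:R^-1))).
  by rewrite ler_pM2l ?mulr_gt0// ler_pM2l// ltr0n.
rewrite mulrA ltr_pdivrMr// [ltRHS]mulrC -ltr_pdivrMr//.
apply: (@lt_trans _ _ (Num.truncn (2 * pi * q.+1%:R / r)).+1%:R).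
  exact: truncnS_gt.
by rewrite ltr_nat.
Qed.

(** A rational sum places [x] in one of countably many null sets, indexed by the denominator;
    unboundedness of d_N (V - V_N) alone serves all of them. *)
Lemma floor_series_ae_irrational
    (mu : {measure set (measurableTypeR R) -> \bar R}) :
  (0 < fourier_dim mu)%E ->
  (forall (T : R) (K : nat), exists2 N : nat, (K <= N)%N &
     T <= (d N)%:R * (V - \sum_(1 <= n < N.+1) slope_term n)) ->
  {ae mu, forall x : R, irrational_series (floor_term x)}.
Proof.
move=> /ereal_sup_gt[_ [eta [_ dec] <-]]; rewrite lte_fin => eta0 unb.
have wi t : mu.-integrable setT
    (EFin \o (fun x : measurableTypeR R => cos (2 * pi * x * t))).
  have [/(_ t)[+ _] _] := dec; congr (integrable _ _ _).
  by apply/funext => x /=; rewrite cosN.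
pose s (q N : nat) : R := q.+1%:R * ((d N)%:R * (V - \sum_(1 <= n < N.+1) slope_term n)).
apply: (@negligibleS _ _ _ _ (\bigcup_q [set x : measurableTypeR R |
  exists K : nat, forall N : nat, (K <= N)%N -> 1 / 2 <= cos (2 * pi * x * s q N)])).
  move=> x /= nirr; have [S cS ratS] := floor_series_cvg x.
  have [/ratS[q [K h]]|irr] := pselect (rational S); first by exists q => //; exists K.
  by case: nirr; exists S.
apply: negligible_bigcup => q.
apply: wave_ev_large_negligible => //.
  exact: cos_integral_decay dec.
(* Bounding below by [Num.max T 0] keeps the value nonnegative, so the factor q+1 can only increase
   it. *)
move=> T K; have [N KN hN] := unb (Num.max T 0) K; exists N => //.
move: hN; rewrite ge_max => /andP[hT h0].
have s0 : 0 <= s q N by apply: mulr_ge0.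
rewrite (ger0_norm s0) /s; apply: (le_trans hT).
by rewrite ler_peMl// ler1n.
Qed.

End FloorSeries.

(** * Factorial growth and the series with slopes n^-alpha *)

Lemma fact_ge_cubic n : (6 <= n)%N -> (n * (n.+1 * n.+2) <= n`!)%N.
Proof.
(* The induction starts at 6, as 5 * 6 * 7 exceeds 5!. *)
elim: n => // n IH; rewrite leq_eqVlt => /predU1P[<-//|n6].
rewrite factS leq_mul2l /=; apply: leq_trans (IH n6); nia.
Qed.

Lemma nonneg_series_cvg (R : realType) (a : nat -> R) (B : R) :
  (forall n, (0 < n)%N -> 0 <= a n) ->
  (forall N, \sum_(1 <= n < N) a n <= B) ->
  exists2 V : R, (\sum_(1 <= n < N) a n) @[N --> \oo] --> V &
    forall N, \sum_(1 <= n < N) a n <= V.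
Proof.
move=> a0 aB; pose A N := \sum_(1 <= n < N) a n.
have ndA : nondecreasing_seq A.
  by apply: (@nondecreasing_series _ _ xpredT) => n n1 _; exact: a0.
have cA : cvgn A.
  by apply: nondecreasing_is_cvgn => //; exists B => _ [N _ <-]; exact: aB.
by exists (limn A) => // N; exact: nondecreasing_cvgn_le.
Qed.

(** Comparison with 1/m - 1/(m+1), which telescopes; the induction carries the sharper bound 2 -
    1/(M+1). *)
Lemma zeta_partial_sum_le (R : realType) (alpha N : nat) : (2 <= alpha)%N ->
  \sum_(1 <= n < N) (n%:R ^- alpha : R) <= 2.
Proof.
move=> a2; suff h M : \sum_(1 <= n < M.+2) (n%:R ^- alpha : R) <= 2 - M.+1%:R^-1.
  case: N => [|[|M]]; [by rewrite big_geq..|].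
  by apply: le_trans (h M) _; rewrite gerBl invr_ge0.
elim: M => [|M IH]; first by rewrite big_nat1 expr1n invr1; lra.
rewrite big_nat_recr//=; apply: (le_trans (lerD IH (lexx _))).
set m : R := M.+1%:R; have m0 : 0 < m by rewrite ltr0n.
have -> : M.+2%:R = m + 1 :> R by rewrite /m natr1.
clearbody m.
have : (m + 1) ^- alpha <= (m + 1) ^- 2.
  rewrite lef_pV2 ?posrE ?exprn_gt0 ?addr_gt0//.
  by apply: ler_weXn2l => //; rewrite lerDr ltW.
have : (m + 1) ^- 2 <= m^-1 - (m + 1)^-1.
  have -> : m^-1 - (m + 1)^-1 = (m * (m + 1))^-1.
    by field; rewrite !gt_eqF ?addr_gt0.
  rewrite lef_pV2 ?posrE ?exprn_gt0 ?mulr_gt0 ?addr_gt0//.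
  by rewrite expr2 ler_pM2r ?addr_gt0// lerDl.
lra.
Qed.

Section ZetaSeries.
Context (R : realType) (alpha : nat).
Hypothesis alpha_ge2 : (2 <= alpha)%N.

Let d n := (n`! ^ alpha)%N.

Lemma zeta_slope n : (0 < n)%N ->
  slope_term R d (fun=> 1%N) (fun=> 1) n = n%:R ^- alpha.
Proof.
case: n => // n _; rewrite /slope_term /d /= mul1r mulr1 factS expnMn natrM invfM.
by rewrite mulrCA divff ?mulr1 ?natrX// expf_neq0// pnatr_eq0 -lt0n fact_gt0.
Qed.

Lemma zeta_floor_series_ae_irrational
    (mu : {measure set (measurableTypeR R) -> \bar R}) :
  (0 < fourier_dim mu)%E ->
  {ae mu, forall x : R, irrational_series
    (fun n => floorR ((n.-1)`!%:R ^+ alpha * x) / (n`!%:R) ^+ alpha)}.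
Proof.
move=> hdim.
have slopeE N : \sum_(1 <= n < N) slope_term R d (fun=> 1%N) (fun=> 1) n =
    \sum_(1 <= n < N) n%:R ^- alpha.
  by apply: eq_big_nat => n /andP[n0 _]; exact: zeta_slope.
have [V cV leV] : exists2 V : R,
    (\sum_(1 <= n < N) (n%:R ^- alpha : R)) @[N --> \oo] --> V &
    forall N, \sum_(1 <= n < N) (n%:R ^- alpha : R) <= V.
  apply: (@nonneg_series_cvg _ _ 2) => [n _|N].
    by rewrite invr_ge0 exprn_ge0.
  exact: zeta_partial_sum_le.
suff : {ae mu, forall x : R,
    irrational_series (floor_term R d (fun=> 1%N) (fun=> 1) x)}.
  apply: filterS; first exact: (ae_filter_ringOfSetsType mu).
  move=> x; congr irrational_series; apply/funext => n.
  by rewrite /floor_term /d mul1r mulr1 !natrX.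
apply: (@floor_series_ae_irrational R d (fun=> 1%N) (fun=> 1) V) => //.
- by move=> n; rewrite expn_gt0 fact_gt0.
- by move=> n; rewrite dvdn_exp2r// factS dvdn_mull.
- move=> n; rewrite /d factS expnMn leq_mul2r; apply/orP; right.
  by rewrite -[leqLHS]expn1 leq_pexp2l// ltnW.
- by move=> n; rewrite normr1.
- by under eq_fun do rewrite slopeE.
move=> T K; pose N := (K + (Num.truncn T).+1 + 6)%N; exists N.
  by rewrite /N -addnA leq_addr.
have TN : T <= N%:R.
  apply: ltW (lt_le_trans (truncnS_gt T) _).
  by rewrite ler_nat /N -addnA addnCA leq_addr.
rewrite slopeE; apply: (le_trans TN).
(* The first omitted term is enough: V - V_N is at least (N+1)^-alpha, and (N! / (N+1))^alpha is at
   least N. *)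
have := leV N.+2; rewrite big_nat_recr//= => h.
apply: (@le_trans _ _ ((d N)%:R * N.+1%:R ^- alpha)); last first.
  by rewrite ler_wpM2l// lerBrDl.
rewrite /d natrX -exprVn -exprMn.
have hN : N%:R <= N`!%:R / N.+1%:R :> R.
  rewrite ler_pdivlMr ?ltr0n// -natrM ler_nat.
  have : (6 <= N)%N by rewrite /N leq_addl.
  by move=> /fact_ge_cubic; apply: leq_trans; rewrite leq_mul2l leq_pmulr ?orbT.
apply: (le_trans hN); rewrite -[leLHS]expr1; apply: ler_weXn2l.
  by apply: le_trans hN; rewrite ler1n /N addnS.
exact: ltnW.
Qed.

End ZetaSeries.

(** * Integer logarithms in base 2 *)

Lemma floor_log2 (R : realType) (n : nat) : (0 < n)%N ->
  floorR (log2 (n%:R : R)) = (trunc_log 2 n)%:R.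
Proof.
move=> n0; rewrite /floorR; have -> // : Num.floor (log2 n%:R : R) = trunc_log 2 n.
apply: floor_def.
have /andP[lo hi] := trunc_log_bounds (isT : (1 < 2)%N) n0.
set k := trunc_log 2 n in lo hi *.
have ln2 : 0 < ln 2 :> R by rewrite ln_gt0// ltr1n.
have nR : 0 < n%:R :> R by rewrite ltr0n.
have powln (j : nat) : j%:R * ln 2 = ln ((2 ^ j)%:R) :> R.
  by rewrite natrX lnXn// mulr_natl.
have pow0 (j : nat) : 0 < (2 ^ j)%:R :> R by rewrite ltr0n expn_gt0.
rewrite /log2 ler_pdivlMr// ltr_pdivrMr//.
have -> : (k%:Z + 1)%:~R = k.+1%:R :> R by rewrite intrD -pmulrn natr1.
by rewrite -pmulrn !powln ler_ln ?ltr_ln ?posrE// ler_nat ltr_nat lo hi.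
Qed.

(** With k the logarithm of M, the bound M < 2^(k+1) either stays strict for M+1 or becomes an
    equality. *)
Lemma trunc_log2_succ M : (0 < M)%N ->
  trunc_log 2 M.+1 = trunc_log 2 M \/
  trunc_log 2 M.+1 = (trunc_log 2 M).+1 /\ M.+1 = (2 ^ (trunc_log 2 M).+1)%N.
Proof.
move=> M0; have /andP[lo hi] := trunc_log_bounds (isT : (1 < 2)%N) M0.
move: hi; rewrite leq_eqVlt => /predU1P[E|hi]; [right|left].
  by split=> //; rewrite {1}E trunc_expnK.
by apply: trunc_log_eq => //; rewrite hi ltnW.
Qed.

(* Abel summation: the increments of [trunc_log 2] sit at the powers of 2. *)
Lemma sum_trunc_log2 (R : realType) (M : nat) :
  \sum_(1 <= j < M.+1) ((trunc_log 2 j)%:R / (j%:R * j.+1%:R) : R) =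
  1 - 2 ^- (trunc_log 2 M.+1) - (trunc_log 2 M.+1)%:R / M.+1%:R.
Proof.
elim: M => [|M IH].
  by rewrite big_geq// trunc_log1 expr0 invr1 mul0r subrr subr0.
rewrite big_nat_recr//= IH.
set m : R := M.+1%:R.
have m0 : m != 0 by rewrite pnatr_eq0.
have m1 : m + 1 != 0 by rewrite natr1 pnatr_eq0.
have -> : M.+2%:R = m + 1 :> R by rewrite natr1.
have [->|[-> E]] := @trunc_log2_succ M.+1 isT.
  by clearbody m; field; rewrite m0 m1 expf_neq0.
set k := trunc_log 2 M.+1 in E *.
(* At a power of 2, the drop from 2^-k to 2^-(k+1) equals 1/(m+1), the effect of the jump of the
   logarithm. *)
have E' : m + 1 = 2 * 2 ^+ k by rewrite natr1 E natrX exprS.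
have -> : 2 ^- k = 2 / (m + 1) :> R.
  by rewrite E' invfM mulrA divff// mul1r.
by clearbody m; rewrite exprS -E' -natr1; field; rewrite m0 m1.
Qed.

Lemma sqr_trunc_log2_le n : (trunc_log 2 n ^ 2 <= 2 * n)%N.
Proof.
have [->|n0] := posnP n; first by rewrite trunc_log0.
have sq k : (k ^ 2 <= 2 * 2 ^ k)%N.
  (* The step needs (k+1)^2 <= 2 k^2, true from k = 3 on; smaller cases are computed. *)
  elim: k => [//|[|[|[|k]]] IH] //.
  rewrite expnS; apply: leq_trans (leq_mul (leqnn 2) IH); nia.
by apply: leq_trans (sq _) _; rewrite leq_mul2l /= trunc_logP.
Qed.

(** * The alternating series with logarithmic factors *)

Section AlternatingLogSeries.
Context (R : realType).

Let lg := trunc_log 2.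
Let slope := slope_term R factorial lg (fun n => (-1) ^+ n).
(** The sum of the slopes at 2j and 2j+1, whose logarithms agree. *)
Let pair_term (j : nat) : R := (lg j.*2)%:R / (j.*2%:R * j.*2.+1%:R).

Lemma alt_slope n : (0 < n)%N -> slope n = (-1) ^+ n * ((lg n)%:R / n%:R).
Proof.
case: n => // n _; rewrite /slope /slope_term /= factS natrM rmorphXn/= rmorphN1.
by congr (_ * _); field; rewrite addrC natr1 !pnatr_eq0 -!lt0n fact_gt0.
Qed.

Lemma lg_pair j : (0 < j)%N -> lg j.*2.+1 = (lg j).+1 /\ lg j.*2 = (lg j).+1.
Proof.
move=> j0; rewrite /lg trunc_log2_double//; split=> //.
rewrite trunc_log2S; last by rewrite ltnS double_gt0.
by rewrite /= uphalf_double.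
Qed.

(* No power of 2 separates 2j from 2j+1, so consecutive terms pair up. *)
Lemma alt_slope_sum_even m :
  \sum_(1 <= n < m.+1.*2) slope n = \sum_(1 <= j < m.+1) pair_term j.
Proof.
elim: m => [|m IH].
  (* The unpaired slope at n = 1 vanishes, since log 1 = 0. *)
  by rewrite big_nat1 big_geq// alt_slope// /lg trunc_log1 mul0r mulr0.
have step k : \sum_(1 <= n < k.+3) slope n =
    \sum_(1 <= n < k.+1) slope n + (slope k.+1 + slope k.+2).
  by rewrite addrA 2?big_nat_recr.
rewrite [LHS]step -doubleS IH [RHS]big_nat_recr//=; congr (_ + _).
have [lg1 lg0] := lg_pair m.+1 isT.
have sgn : (-1) ^+ m.+1.*2 = 1 :> R by rewrite -signr_odd odd_double.
rewrite !alt_slope ?double_gt0// /pair_term lg1 lg0 (exprS _ m.+1.*2) sgn.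
rewrite -(natr1 m.+1.*2).
have p0 : m.+1.*2%:R != 0 :> R by rewrite pnatr_eq0 double_eq0.
have p1 : m.+1.*2%:R + 1 != 0 :> R by rewrite natr1 pnatr_eq0.
by move: (m.+1.*2%:R) p0 p1 => p p0 p1; field; rewrite p0 p1.
Qed.

(** Since lg(2j) = lg j + 1, each pair is at most (lg j + 1) / (j (j+1)); the Abel sum and the
    telescoping sum of 1 / (j (j+1)) each contribute at most 1. *)
Lemma pair_term_sum_le m : \sum_(1 <= j < m) pair_term j <= 2.
Proof.
case: m => [|m]; first by rewrite big_geq.
apply: (@le_trans _ _ (\sum_(1 <= j < m.+1)
    ((lg j)%:R / (j%:R * j.+1%:R) + (j%:R^-1 - j.+1%:R^-1)))).
  apply: ler_sum_nat => j /andP[j0 _].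
  have [_ lg0] := lg_pair j j0; rewrite /pair_term lg0 -!natr1 -mul2n natrM.
  have jR : 1 <= j%:R :> R by rewrite ler1n.
  move: (j%:R) jR ((lg j)%:R) (ler0n R (lg j)) => x x1 y y0.
  have -> : y / (x * (x + 1)) + (x^-1 - (x + 1)^-1) = (y + 1) / (x * (x + 1)).
    by field; rewrite !gt_eqF//; lra.
  rewrite ler_pM2l; last lra.
  by rewrite lef_pV2 ?posrE; nra.
rewrite big_split/= sum_trunc_log2.
rewrite (@telescope_sumr_eq _ 1 m.+1 (fun j => - j%:R^-1))//; last first.
  by move=> j _; rewrite opprK addrC.
rewrite invr1 opprK.
have : 0 <= (2 ^- trunc_log 2 m.+1 : R) by rewrite invr_ge0 exprn_ge0.
have : 0 <= (trunc_log 2 m.+1)%:R / m.+1%:R :> R by rewrite divr_ge0.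
have : 0 <= m.+1%:R^-1 :> R by rewrite invr_ge0.
set a := 2 ^- _; set b := _ / m.+1%:R; set c := m.+1%:R^-1.
clearbody a b c; lra.
Qed.

Lemma alt_slope_small (eps : R) : 0 < eps ->
  exists K : nat, forall n, (K < n)%N -> `|slope n| <= eps.
Proof.
(* As (lg n)^2 <= 2n, it suffices that 2n <= eps^2 n^2. *)
move=> e0; exists (Num.truncn (2 / eps ^+ 2)).+1 => n Kn.
have n0 : (0 < n)%N by exact: leq_trans Kn.
have nR : 0 < n%:R :> R by rewrite ltr0n.
rewrite alt_slope// normrM normrX normrN1 expr1n mul1r ger0_norm ?divr_ge0//.
rewrite ler_pdivrMr// -(@ler_pXn2r _ 2) ?nnegrE ?mulr_ge0 ?(ltW e0)//.
have : (lg n)%:R ^+ 2 <= 2 * n%:R :> R.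
  by rewrite -natrX -natrM ler_nat sqr_trunc_log2_le.
move=> /le_trans; apply; rewrite exprMn (expr2 n%:R) mulrA ler_pM2r//.
rewrite mulrC -ler_pdivrMr ?exprn_gt0//.
apply: ltW (lt_le_trans (truncnS_gt _) _).
by rewrite ler_nat ltnW.
Qed.

(** Sums over n < N are sums of pairs when N is even; an odd N adds one slope, which tends to 0. *)
Lemma alt_slope_cvg (V : R) :
  (\sum_(1 <= j < m) pair_term j) @[m --> \oo] --> V ->
  (\sum_(1 <= n < N) slope n) @[N --> \oo] --> V.
Proof.
move=> /cvgrPdist_le cV; apply/cvgrPdist_le => eps e0.
have e2 : 0 < eps / 2 by lra.
have [M _ MP] := cV _ e2; have [K KP] := alt_slope_small _ e2.
exists (M.+1.*2 + K.+2)%N => // N /= NMK.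
have [m Nm] : exists m, N./2 = m.+1.
  by exists N./2.-1; lia.
have Mm : (M <= m.+1)%N by lia.
have h := MP _ Mm; rewrite /= in h.
have NE := odd_double_half N; rewrite Nm in NE.
case: (odd N) NE => /= NE; last first.
  by rewrite -NE add0n alt_slope_sum_even (le_trans h)//; lra.
rewrite -NE add1n big_nat_recr//= alt_slope_sum_even.
have /KP h2 : (K < m.+1.*2)%N by lia.
rewrite opprD addrA; apply: (le_trans (ler_normB _ _)); lra.
Qed.

Lemma alternating_floor_series_ae_irrational
    (mu : {measure set (measurableTypeR R) -> \bar R}) :
  (0 < fourier_dim mu)%E ->
  {ae mu, forall x : R, irrational_series
    (fun n => (-1) ^+ n * (floorR ((n.-1)`!%:R * x * (lg n)%:R) / n`!%:R))}.
Proof.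
move=> hdim.
have [V cV leV] : exists2 V : R,
    (\sum_(1 <= j < m) pair_term j) @[m --> \oo] --> V &
    forall m, \sum_(1 <= j < m) pair_term j <= V.
  apply: (@nonneg_series_cvg _ _ 2) => [n _|N]; last exact: pair_term_sum_le.
  by rewrite divr_ge0// mulr_ge0.
suff : {ae mu, forall x : R,
    irrational_series (floor_term R factorial lg (fun n => (-1) ^+ n) x)}.
  apply: filterS; first exact: (ae_filter_ringOfSetsType mu).
  move=> x; congr irrational_series; apply/funext => n.
  by rewrite /floor_term rmorphXn/= rmorphN1.
apply: (@floor_series_ae_irrational R factorial lg (fun n => (-1) ^+ n) V) => //.
- exact: fact_gt0.
- by move=> n; rewrite factS dvdn_mull.
- by move=> n; rewrite rmorphXn/= rmorphN1 normrX normrN1 expr1n.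
- exact: alt_slope_cvg.
(* An odd index makes the partial sum end with a complete pair. *)
move=> T K; pose m := (K + (Num.truncn T).+1 + 6)%N; exists m.*2.+1.
  by rewrite /m; lia.
have TN : T <= m.*2.+1%:R.
  apply: ltW (lt_le_trans (truncnS_gt T) _).
  rewrite ler_nat; apply: (@leq_trans m); last by clearbody m; lia.
  by rewrite /m -addnA addnCA leq_addr.
apply: (le_trans TN); rewrite -doubleS -/slope alt_slope_sum_even.
(* The next pair bounds V - V_N below by 1 / ((N+1)(N+2)), its logarithm being at least 1; N!
   outgrows this by a factor N. *)
have := leV m.+2; rewrite big_nat_recr//= => h.
apply: (@le_trans _ _ ((m.*2.+1)`!%:R * pair_term m.+1)); last first.
  by rewrite ler_wpM2l// lerBrDl.
have [_ lg0] := lg_pair m.+1 isT.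
apply: (@le_trans _ _ ((m.*2.+1)`!%:R / (m.+1.*2%:R * m.+1.*2.+1%:R))).
  rewrite ler_pdivlMr ?mulr_gt0 ?ltr0n// -!natrM ler_nat doubleS.
  by apply: fact_ge_cubic; rewrite /m; lia.
by rewrite ler_wpM2l// /pair_term lg0 ler_peMl ?ler1n.
Qed.

End AlternatingLogSeries.

Theorem theorem3 (R : realType)
    (mu : {measure set (measurableTypeR R) -> \bar R}) (alpha : nat)
    (hmu : radon_measure mu) (hdim : (0 < fourier_dim mu)%E)
    (halpha : (2 <= alpha)%N) :
  {ae mu, forall x : R,
    irrational_series
      (fun n : nat => floorR (((n.-1)`!%:R) ^+ alpha * x) / (n`!%:R) ^+ alpha) /\
    irrational_series
      (fun n : nat =>
         (-1) ^+ n * (floorR ((n.-1)`!%:R * x * floorR (log2 n%:R)) / n`!%:R))}.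
Proof.
have := alternating_floor_series_ae_irrational R mu hdim.
have := zeta_floor_series_ae_irrational R alpha halpha mu hdim.
apply: filterS2; first exact: (ae_filter_ringOfSetsType mu).
move=> x zx [S cS irrS].
split=> //; exists S => //.
(* [floor_log2] requires n > 0, so the two series are identified through their partial sums, which
   start at 1. *)
rewrite [X in X @ _](_ : _ = (fun N => \sum_(1 <= n < N)
  (-1) ^+ n * (floorR ((n.-1)`!%:R * x * (trunc_log 2 n)%:R) / n`!%:R)))//.
apply/funext => N; apply: eq_big_nat => n /andP[n0 _].
by rewrite floor_log2.
Qed.
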